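(* Let $G$ be a finitely generated group, let $\mu$ be a finitely supported probability measure on $G$ whose support generates $G$ and with $\mu(1)>0$, and let $(R_n)_{n\ge 0}$ be the random walk on $G$ with step distribution $\mu$. If $$\limsup_{n\to\infty}\Pr\left(R_n^2=1\right)>0,$$ then $G$ is virtually abelian.
   Context: The random walk with step distribution $\mu$ is $R_0=1$, $R_{n+1}=R_n x_n$ with $x_0,x_1,\dots$ i.i.d. of law $\mu$; thus $R_n$ has law $\mu^{*n}$. A group is virtually abelian if it has an abelian subgroup of finite index. The paper's standing assumption is that random walks have a finitely supported generating step distribution with $\mu(1)>0$ (lazy walks). *)

(* Defs.v *)
From HB Require Import structures.
From mathcomp Require Import all_boot all_order all_algebra finmap.
From mathcomp Require Import all_classical all_reals all_analysis.

Set Implicit Arguments.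
Unset Strict Implicit.
Unset Printing Implicit Defensive.

Local Open Scope classical_set_scope.
Local Open Scope group_scope.

Section Groups.
Variable G : groupType.

Definition generates (S : set G) : Prop :=
  forall H : {pred G}, group_closed H -> S `<=` [set` H] ->
  forall g : G, g \in H.

Definition finitely_generated : Prop :=
  exists S : set G, finite_set S /\ generates S.

Definition left_cosets (H : {pred G}) : set (set G) :=
  [set [set g * h | h in [set` H]] | g in [set: G]].

Definition virtually_abelian : Prop :=
  exists H : {pred G},
    [/\ group_closed H,
        {in H &, forall a b, commute a b} &
        finite_set (left_cosets H)].

End Groups.

Arguments finitely_generated G : clear implicits.
Arguments virtually_abelian G : clear implicits.

(* The group G, equipped with the sigma-algebra of all its subsets. *)
Definition discrete (G : groupType) : Type := G.

Section DiscreteGroup.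
Variable G : groupType.

HB.instance Definition _ := Group.on (discrete G).
HB.instance Definition _ := isPointed.Build (discrete G) (1 : G).
HB.instance Definition _ := @isMeasurable.Build default_measure_display
  (discrete G) (@discrete_measurable (discrete G))
  (@discrete_measurable0 (discrete G)) (@discrete_measurableC (discrete G))
  (@discrete_measurableU (discrete G)).

End DiscreteGroup.

Section StepDistribution.
Context (R : realType) (G : groupType).
Implicit Type mu : probability (discrete G) R.

Definition msupport mu : set G := [set g : G | (0 < mu [set g])%E].

Definition finitely_supported mu : Prop :=
  exists2 F : set G, finite_set F & mu F = 1%E.

End StepDistribution.

Section IID.
Context (d d' : measure_display) (Omega : measurableType d)
  (E : measurableType d') (R : realType) (P : probability Omega R).

Definition independent (I : choiceType) (X : I -> {RV P >-> E}) : Prop :=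
  forall (J : {fset I}) (A : I -> set E),
    (forall i, i \in J -> measurable (A i)) ->
    P (\bigcap_(i in [set` J]) (X i @^-1` A i)) =
    (\prod_(i <- J) P (X i @^-1` A i))%E.

Definition iid (mu : probability E R) (X : nat -> {RV P >-> E}) : Prop :=
  independent X /\
  forall n (A : set E), measurable A -> distribution P (X n) A = mu A.

End IID.

Fixpoint random_walk (G : groupType) (Omega : Type) (x : nat -> Omega -> G)
    (n : nat) (w : Omega) : G :=
  if n is m.+1 then random_walk x m w * x m w else 1.

(* Main.v *)
Require Import Defs.
From HB Require Import structures.
From mathcomp Require Import all_boot all_order all_algebra finmap.
From mathcomp Require Import all_classical all_reals all_analysis.
From mathcomp Require Import ring lra.

(** Write R_n = X Y with X the first m steps and Y the remaining k = n - m, and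
let Y' be an independent copy of Y.  If R_n squares to 1 with probability at
least c, then by Cauchy-Schwarz X Y and X Y' both square to 1 with
probability at least c^2.  When they do, X conjugates b = Y^-1 Y' to Y Y'^-1
([conj_of_involutions]): once Y and Y' are fixed, X moves b to one prescribed
point of its conjugacy class.

The analytic input is [hit_decay]: for a lazy walk, the probability of being at
a prescribed point of an infinite orbit tends to 0, uniformly over all actions
of G, all starting points and all targets.  Applied to conjugation it says that
for m large the event above is negligible unless b lies in the FC-centre, the
set of elements with finitely many conjugates.  Hence Y and Y' lie in the same
coset of the FC-centre with probability at least about c^2, and the same lemma,
applied now to the action of G on cosets, shows that the FC-centre has finite
index ([fc_center_finite_index]).  It then inherits finite generation from G,
so its centre is the intersection of finitely many centralizers of finite index
and is the required abelian subgroup ([virtually_abelian_of_fc]).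

The decay lemma rests on the l^2 norm of the distribution of the walk on the
orbit, which no step increases and a lazy step decreases unless the distribution
is locally constant.  As the orbit is infinite and connected under the steps, a
distribution that charges some point at least e
cannot vary by less than a constant d(e) along every edge, for it would then be
at least e/2 at more than 2/e points ([flat_growth]).  Each step taken while
some atom has mass at least e therefore destroys a fixed amount of the squared
norm ([sqnorm_step]), which is at most 1, so it happens boundedly often.

Everything after the reduction to the law of the walk is finite: [expect n F] is
a finite sum over weighted words, and [walk_prob_le] bounds the probabilities of
the given walk by such sums; measurability there uses that G is countable. *)

Set Implicit Arguments.
Unset Strict Implicit.
Unset Printing Implicit Defensive.

Import Order.TTheory GRing.Theory Num.Theory.

Local Open Scope classical_set_scope.
Local Open Scope group_scope.

(** * Generating sets and group actions *)

Lemma generates_ind (G : groupType) (S : set G) (Q : G -> Prop) :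
  generates S -> Q 1 -> (forall g h, Q g -> Q h -> Q (g * h)) ->
  (forall s, S s -> Q s /\ Q s^-1) -> forall g, Q g.
Proof.
move=> genS Q1 QM QS; pose H : {pred G} := [pred g | `[< Q g /\ Q g^-1 >]].
have HH : group_closed H.
  split=> [|g h /asboolP[Qg QgV] /asboolP[Qh QhV]]; apply/asboolP.
    by rewrite invg1.
  by rewrite invgF; split; exact: QM.
have SH : S `<=` [set` H] by move=> s /QS Qs; apply/asboolP.
by move=> g; have /asboolP[] := genS H HH SH g.
Qed.

(** Every element is the value of a word in the letters S and S^-1, and words
are coded by lists of pairs of a sign and an index into S. *)
Lemma generates_countable (G : groupType) (S : seq G) :
  generates [set` S] -> countable [set: G].
Proof.
move=> genS.
pose letter (p : bool * nat) := if p.1 then nth 1 S p.2 else (nth 1 S p.2)^-1.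
pose word := foldr (fun p g => g * letter p) 1.
have wordT g : forall l, exists l', word l' = word l * g.
  move: g; apply: (generates_ind genS) => [l|g h wg wh l|s sS].
  - by exists l; rewrite mulg1.
  - by have [k kE] := wg l; have [l' lE] := wh k; exists l'; rewrite lE kE mulgA.
  - by split=> l; [exists ((true, index s S) :: l)|exists ((false, index s S) :: l)];
      rewrite /= /letter/= nth_index.
apply: (@sub_countable _ _ _ [set: seq (bool * nat)]); last exact: countableP.
have -> : [set: G] = word @` setT.
  apply/seteqP; split=> // g _; have [l lg] := wordT g [::].
  by exists l => //; rewrite lg mul1g.
exact: card_image_le.
Qed.

Section GroupAction.
Variables (G : groupType) (T : eqType).

Definition right_action (act : T -> G -> T) : Prop :=
  (forall t, act t 1 = t) /\
  (forall t g h, act t (g * h) = act (act t g) h).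

Definition infinite_orbit (act : T -> G -> T) (t : T) : Prop :=
  forall U : seq T, exists g, act t g \notin U.

Variable act : T -> G -> T.
Hypothesis actP : right_action act.

Lemma right_actionK g t : act (act t g) g^-1 = t.
Proof. by rewrite -actP.2 mulgV actP.1. Qed.

Lemma right_actionVK g t : act (act t g^-1) g = t.
Proof. by rewrite -actP.2 mulVg actP.1. Qed.

Lemma infinite_orbit_act t g :
  infinite_orbit act t -> infinite_orbit act (act t g).
Proof.
move=> Hinf U; have [h hU] := Hinf U.
by exists (g^-1 * h); rewrite actP.2 right_actionK.
Qed.

(** Only steps of one sign are needed to leave a finite set of an infinite
orbit: a finite set stable under s^-1 for all s in S is stable under the group
that S generates. *)
Lemma escape_step (S : seq G) (t : T) (U : seq T) :
  generates [set` S] -> infinite_orbit act t -> uniq U -> t \in U ->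
  exists v s, [/\ v \in U, s \in S & act v s^-1 \notin U].
Proof.
move=> genS Hinf Uuniq tU; apply: contrapT => stay.
have stayV v s : v \in U -> s \in S -> act v s^-1 \in U.
  by move=> vU sS; apply/negPn/negP => nU; apply: stay; exists v, s.
(* An injective self-map of a finite set is onto, so the set is also stable
     under the inverse steps. *)
have stayS v s : v \in U -> s \in S -> act v s \in U.
  move=> vU sS; pose V := [seq act u s^-1 | u <- U].
  have Vuniq : uniq V.
    by rewrite map_inj_uniq// => a b /(congr1 (act^~ s)); rewrite !right_actionVK.
  have VU : {subset V <= U} by move=> _ /mapP[u uU ->]; exact: stayV.
  have [_ VE] := uniq_min_size Vuniq VU (eq_leq (esym (size_map _ _))).
  by move: vU; rewrite -VE => /mapP[u uU ->]; rewrite right_actionVK.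
have [g] := Hinf U; rewrite (_ : _ \in U)//.
move: g t tU {Hinf}; apply: (generates_ind genS).
- by move=> v vU; rewrite actP.1.
- by move=> g h gU hU v vU; rewrite actP.2; apply/hU/gU.
- by move=> s sS; split=> v vU; [exact: stayS|exact: stayV].
Qed.

End GroupAction.

(** * Finitely supported walks and the decay of hitting probabilities *)

Section FiniteWalk.
Local Open Scope ring_scope.
Context (R : realType) (G : groupType) (S : seq G) (w : G -> R).

(** The law of the walk after n steps, as a list of weighted words; distinct
words with the same value are kept apart, so that expectations are plain sums. *)
Fixpoint walk (n : nat) : seq (R * G) :=
  if n is m.+1 then [seq (p.1 * w s, (p.2 * s)%g) | p <- walk m, s <- S]
  else [:: (1, 1%g)].

Definition expect (n : nat) (F : G -> R) : R := \sum_(p <- walk n) p.1 * F p.2.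

Lemma expect0 F : expect 0 F = F 1%g.
Proof. by rewrite /expect big_seq1 mul1r. Qed.

Lemma expectS n F :
  expect n.+1 F = \sum_(s <- S) w s * expect n (fun g => F (g * s)%g).
Proof.
rewrite /expect /= big_allpairs_dep exchange_big /=; apply: eq_bigr => s _.
by rewrite mulr_sumr; apply: eq_bigr => p _; rewrite mulrA (mulrC (w s)).
Qed.

Lemma eq_expect n F F' : F =1 F' -> expect n F = expect n F'.
Proof. by move=> FF; apply: eq_bigr => p _; rewrite FF. Qed.

Lemma expect_sum n (I : Type) (r : seq I) (F : I -> G -> R) :
  expect n (fun g => \sum_(i <- r) F i g) = \sum_(i <- r) expect n (F i).
Proof.
rewrite /expect exchange_big /=; apply: eq_bigr => p _.
by rewrite mulr_sumr.
Qed.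

Lemma expectZ n c F : expect n (fun g => c * F g) = c * expect n F.
Proof. by rewrite /expect mulr_sumr; apply: eq_bigr => p _; rewrite mulrCA. Qed.

Lemma expectD n F F' :
  expect n (fun g => F g + F' g) = expect n F + expect n F'.
Proof.
by rewrite /expect -big_split/=; apply: eq_bigr => p _; rewrite mulrDr.
Qed.

Lemma expect_exchange m n F :
  expect m (fun g => expect n (F g)) = expect n (fun h => expect m (F^~ h)).
Proof.
rewrite /expect; under eq_bigr do rewrite mulr_sumr.
rewrite exchange_big /=; apply: eq_bigr => p _.
by rewrite mulr_sumr; apply: eq_bigr => q _; rewrite mulrCA.
Qed.

Lemma expect_add m n F :
  expect (m + n) F = expect m (fun g => expect n (fun h => F (g * h)%g)).
Proof.
elim: n F => [|n IH] F.
  by rewrite addn0; apply: eq_expect => g; rewrite expect0 mulg1.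
rewrite addnS expectS; under eq_bigr do rewrite IH -expectZ.
rewrite -expect_sum; apply: eq_expect => g; rewrite expectS.
by apply: eq_bigr => s _; congr (_ * _); apply: eq_expect => h; rewrite mulgA.
Qed.

Hypothesis w_gt0 : forall s, s \in S -> 0 < w s.
Hypothesis w_sum1 : \sum_(s <- S) w s = 1.

Lemma expect_cst n c : expect n (fun=> c) = c.
Proof.
elim: n => [|n IH]; first by rewrite expect0.
by rewrite expectS; under eq_bigr do rewrite IH; rewrite -mulr_suml w_sum1 mul1r.
Qed.

Lemma le_expect n F F' : (forall g, F g <= F' g) -> expect n F <= expect n F'.
Proof.
elim: n F F' => [|n IH] F F' FF; first by rewrite !expect0.
rewrite !expectS big_seq [leRHS]big_seq; apply: ler_sum => s sS.
by rewrite ler_wpM2l ?IH// ltW ?w_gt0.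
Qed.

Lemma expect_ge0 n F : (forall g, 0 <= F g) -> 0 <= expect n F.
Proof. by move=> F0; rewrite -(expect_cst n 0); exact: le_expect. Qed.

Lemma sqr_expect_le n F : expect n F ^+ 2 <= expect n (fun g => F g ^+ 2).
Proof.
set a := expect n F.
have : 0 <= expect n (fun g => (F g - a) ^+ 2).
  by apply: expect_ge0 => g; exact: sqr_ge0.
rewrite (eq_expect _ (F' := fun g => F g ^+ 2 + ((- (2 * a)) * F g + a ^+ 2))).
  by rewrite !expectD expectZ expect_cst -/a; nra.
by move=> g; ring.
Qed.

Lemma step_weight_min : exists2 c : R, 0 < c & forall s, s \in S -> c <= w s.
Proof.
elim: S w_gt0 => [|s r IH] wgt0; first by exists 1.
case: IH => [u ur|c c0 cr]; first by apply: wgt0; rewrite inE ur orbT.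
exists (Num.min c (w s)); first by rewrite lt_min c0 wgt0// inE eqxx.
move=> u; rewrite inE => /predU1P[->|ur]; first by rewrite ge_min lexx orbT.
by rewrite ge_min cr.
Qed.

Lemma step_sum_ge (X : G -> R) s : (forall g, 0 <= X g) -> s \in S ->
  w s * X s <= \sum_(u <- S) w u * X u.
Proof.
move=> X0 sS; rewrite (big_rem s)//= lerDl big_seq; apply: sumr_ge0 => u uS.
by rewrite mulr_ge0// ltW// w_gt0// (mem_rem uS).
Qed.

Section Action.
Context (T : eqType) (act : T -> G -> T).
Hypothesis actP : right_action act.

(** If f is the distribution of the walk on an orbit, this is the distribution
one step later: the point v is reached from v s^-1 by the step s. *)
Definition step (f : T -> R) (v : T) : R := \sum_(s <- S) w s * f (act v s^-1%g).

Lemma step_ge f v e : e <= step f v -> exists2 s, s \in S & e <= f (act v s^-1%g).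
Proof.
move=> ef; apply: contrapT => nex.
have lt s : s \in S -> f (act v s^-1%g) < e.
  by move=> sS; rewrite ltNge; apply/negP => ?; apply: nex; exists s.
have [s sS] : exists s, s \in S.
  by case: S w_sum1 => [|s r _]; [rewrite big_nil => /eqP; rewrite eq_sym oner_eq0
    | exists s; rewrite inE eqxx].
suff : step f v < e by rewrite ltNge ef.
rewrite /step -[ltRHS]mul1r -w_sum1 mulr_suml (big_rem s)//= [ltRHS](big_rem s)//=.
apply: ltr_leD; first by rewrite ltr_pM2l ?w_gt0 ?lt.
rewrite big_seq [leRHS]big_seq; apply: ler_sum => u uS.
by rewrite ler_wpM2l// ltW// ?lt ?w_gt0// (mem_rem uS).
Qed.

(** A bound on the squared l^2 norm over a possibly infinite T, expressed through
finite partial sums so that no summability is ever required. *)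
Definition sqnorm_le (f : T -> R) (b : R) : Prop :=
  forall U : seq T, uniq U -> \sum_(u <- U) f u ^+ 2 <= b.

Lemma step_variance f v :
  \sum_(s <- S) w s * f (act v s^-1%g) ^+ 2 - step f v ^+ 2 =
  \sum_(s <- S) w s * (f (act v s^-1%g) - step f v) ^+ 2.
Proof.
set m := step f v.
have -> : \sum_(s <- S) w s * (f (act v s^-1%g) - m) ^+ 2 =
    \sum_(s <- S) (w s * f (act v s^-1%g) ^+ 2
      + ((- (2 * m)) * (w s * f (act v s^-1%g)) + w s * m ^+ 2)).
  by apply: eq_bigr => s _; ring.
rewrite !big_split/= -mulr_sumr -mulr_suml w_sum1 -/(step f v) -/m; ring.
Qed.

Hypothesis S1 : 1%g \in S.

(** The loss of squared norm at v is the variance of s |-> f (v s^-1) under the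
step distribution.  Laziness puts the value f v itself among those averaged, so
one of f v and f (v s^-1), which differ by d, is at least d / 2 away from the
mean and carries weight at least c. *)
Lemma sqnorm_step f (b c d : R) v s :
  0 < c -> (forall u, u \in S -> c <= w u) -> 0 <= d -> s \in S ->
  d <= f v - f (act v s^-1%g) ->
  sqnorm_le f b -> sqnorm_le (step f) (b - c * d ^+ 2 / 4).
Proof.
move=> c0 cw d0 sS dv fb U Uuniq.
have var_ge0 u : 0 <= \sum_(s <- S) w s * (f (act u s^-1%g) - step f u) ^+ 2.
  by rewrite big_seq; apply: sumr_ge0 => ? ?; rewrite mulr_ge0 ?sqr_ge0// ltW ?w_gt0.
have var_v : c * d ^+ 2 / 4 <=
    \sum_(s <- S) w s * (f (act v s^-1%g) - step f v) ^+ 2.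
  have key u : u \in S -> d ^+ 2 / 4 <= (f (act v u^-1%g) - step f v) ^+ 2 ->
      c * d ^+ 2 / 4 <= \sum_(s <- S) w s * (f (act v s^-1%g) - step f v) ^+ 2.
    move=> uS du; apply: le_trans (step_sum_ge (fun g => sqr_ge0 _) uS).
    rewrite -mulrA; apply: ler_pM => //; [exact: ltW | | exact: cw].
    by rewrite mulr_ge0 ?sqr_ge0.
  have [h|h] := lerP (d / 2) (f v - step f v).
    by apply: (key 1%g) => //; rewrite invg1 actP.1; nra.
  by apply: (key s) => //; nra.
(* The bound at U follows from the one at a larger set containing v. *)
pose V := if v \in U then U else v :: U.
have Vuniq : uniq V by rewrite /V; case: ifP => //= ->.
have vV : v \in V by rewrite /V; case: ifP => //= _; rewrite inE eqxx.
have UV : \sum_(u <- U) step f u ^+ 2 <= \sum_(u <- V) step f u ^+ 2.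
  by rewrite /V; case: ifP => //= _; rewrite big_cons lerDr sqr_ge0.
apply: (le_trans UV); rewrite lerBrDr.
(* Each translation v |-> v u^-1 is injective, so the translated squares still
   sum to at most b. *)
have : \sum_(u <- V) \sum_(s <- S) w s * f (act u s^-1%g) ^+ 2 <= b.
  rewrite exchange_big /= -[leRHS]mul1r -w_sum1 mulr_suml.
  rewrite big_seq [leRHS]big_seq; apply: ler_sum => u uS.
  rewrite -mulr_sumr ler_wpM2l ?(ltW (w_gt0 uS))//.
  rewrite -(big_map (fun x => act x u^-1%g) xpredT (fun x => f x ^+ 2)).
  apply: (fb [seq act x u^-1%g | x <- V]).
  by rewrite map_inj_uniq// => x y /(congr1 (act^~ u)); rewrite !right_actionVK.
apply: le_trans.
rewrite -lerBrDl -sumrB; under eq_bigr do rewrite step_variance.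
rewrite (big_rem v)//= ler_wpDr// sumr_ge0// => u _; exact: var_ge0.
Qed.

Hypothesis genS : generates [set` S].

(** Escaping from a finite set along an edge costs at most d, so k escapes
produce k + 1 points where f is at least f t - k d. *)
Lemma flat_growth f (d : R) t : infinite_orbit act t -> 0 <= d ->
  (forall v s, s \in S -> f v - f (act v s^-1%g) <= d) ->
  forall k, exists U : seq T, [/\ uniq U, size U = k.+1, t \in U &
    forall v, v \in U -> f t - k%:R * d <= f v].
Proof.
move=> tinf d0 flat; elim=> [|k [U [Uuniq sU tU fU]]].
  exists [:: t]; split=> //; first by rewrite inE.
  by move=> v; rewrite inE => /eqP ->; rewrite mul0r subr0.
have [v [s [vU sS nU]]] := escape_step actP genS tinf Uuniq tU.
exists (act v s^-1%g :: U); split=> /=; rewrite ?sU ?nU ?inE ?tU ?orbT//.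
move=> u; rewrite inE -natr1 => /predU1P[->|/fU].
  by have := flat v s sS; have := fU v vU; lra.
by lra.
Qed.

Definition hit n t u : R := expect n (fun g => (act t g == u)%:R).

Lemma hitS n t u : hit n.+1 t u = step (hit n t) u.
Proof.
rewrite /hit expectS; apply: eq_bigr => s _; congr (_ * _).
apply: eq_expect => g; congr (_%:R); rewrite actP.2.
by congr nat_of_bool; apply/eqP/eqP => [<-|->]; rewrite ?right_actionK ?right_actionVK.
Qed.

Lemma hit_sum n t (U : seq T) : uniq U -> \sum_(u <- U) hit n t u <= 1.
Proof.
move=> Uuniq; rewrite -expect_sum -[leRHS](expect_cst n 1).
apply: le_expect => g; rewrite -natr_sum -[1]/(1%:R) ler_nat.
rewrite -(big_mkcond (fun u => act t g == u) (fun=> 1%N))/= sum1_count.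
rewrite (@eq_count _ _ (pred1 (act t g))) => [|u]; last exact: eq_sym.
by rewrite count_uniq_mem// leq_b1.
Qed.

Lemma hit_orbit n t u : 0 < hit n t u -> exists g, u = act t g.
Proof.
move=> h; apply: contrapT => nex; move: h; rewrite /hit.
rewrite (eq_expect _ (F' := fun=> 0)) ?expect_cst ?ltxx// => g.
by case: eqP => // e; case: nex; exists g.
Qed.

End Action.
End FiniteWalk.

Section Decay.
Local Open Scope ring_scope.
Context (R : realType) (G : groupType) (S : seq G) (w : G -> R).
Hypothesis w_gt0 : forall s, s \in S -> 0 < w s.
Hypothesis w_sum1 : \sum_(s <- S) w s = 1.
Hypothesis S1 : 1%g \in S.
Hypothesis genS : generates [set` S].

(** The threshold N depends on e and the step distribution alone, not on the
action; the uniformity is what allows the conjugated element b and the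
coset to depend on the rest of the walk. *)
Lemma hit_decay (e : R) : 0 < e -> exists N : nat, forall n, (N <= n)%N ->
  forall (T : eqType) (act : T -> G -> T), right_action act ->
  forall t u, infinite_orbit act t -> hit S w act n t u < e.
Proof.
move=> e0; have [c c0 cw] := step_weight_min w_gt0.
have ntrunc (x : R) : 0 <= x -> x < (Num.truncn x).+1%:R.
  by move=> x0; have := truncnS_gt x.
(* With K escapes of cost d the mass is still at least e / 2 at K + 1 points,
   and K is chosen so that these carry total mass more than 1. *)
pose K := Num.truncn (2 / e); pose d := e / (2 * K.+1%:R).
have K0 : 0 < K.+1%:R :> R by rewrite ltr0n.
have d0 : 0 < d by rewrite divr_gt0// mulr_gt0.
have Ke : 1 < K.+1%:R * (e / 2).
  have := ntrunc (2 / e) (ltW (divr_gt0 (ltr0Sn _ _) e0)).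
  by rewrite ltr_pdivrMr// -/K; lra.
have Kd : K%:R * d <= e / 2.
  rewrite /d mulrA ler_pdivrMr; last by rewrite mulr_gt0.
  have : K%:R <= K.+1%:R :> R by rewrite ler_nat.
  by nra.
pose q := c * d ^+ 2 / 4.
have q0 : 0 < q by rewrite /q divr_gt0// mulr_gt0// exprn_gt0.
exists (Num.truncn (q^-1)).+1 => n Nn T act actP t u tinf.
rewrite ltNge; apply/negP => eu.
suff /(_ [::] isT) : sqnorm_le (hit S w act n t) (1 - n%:R * q).
  rewrite big_nil subr_ge0 leNgt => /negP; apply.
  rewrite -ltr_pdivrMr// mul1r; apply: lt_le_trans (ntrunc _ _) _.
    by rewrite invr_ge0 ltW.
  by rewrite ler_nat.
(* A large atom at time n + 1 is an average of masses at time n, so large atoms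
   exist at all earlier times and every step costs q. *)
elim: n u eu {Nn} => [|n IH] u eu.
  rewrite mul0r subr0 => U Uuniq.
  apply: le_trans (hit_sum w_gt0 w_sum1 act 0 t Uuniq); apply: ler_sum => v _.
  by rewrite /hit expect0; case: eqP => _; rewrite ?expr1n ?expr0n.
have hE : hit S w act n.+1 t = step S w act (hit S w act n t).
  by apply/funext => v; rewrite hitS.
move: eu; rewrite hE => /(step_ge w_gt0 w_sum1)[s0 s0S eu].
have [g ug] := hit_orbit w_sum1 (lt_le_trans e0 eu).
set u0 := act u _ in eu ug.
have [v [s [sS dv]]] : exists v s, s \in S /\
    d <= hit S w act n t v - hit S w act n t (act v s^-1%g).
  apply: contrapT => nex.
  have u0inf : infinite_orbit act u0 by rewrite ug; exact: infinite_orbit_act.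
  have flat v s : s \in S ->
      hit S w act n t v - hit S w act n t (act v s^-1%g) <= d.
    move=> sS; rewrite leNgt; apply/negP => dv; apply: nex; exists v, s.
    by split=> //; exact: ltW.
  have [U [Uuniq sU _ fU]] := flat_growth actP genS u0inf (ltW d0) flat K.
  have := hit_sum w_gt0 w_sum1 act n t Uuniq; rewrite leNgt => /negP; apply.
  apply: (lt_le_trans Ke); rewrite -sU -sum1_size natr_sum mulr_suml.
  rewrite big_seq [leRHS]big_seq; apply: ler_sum => x /fU; rewrite mul1r; lra.
rewrite -natr1 mulrDl mul1r opprD addrA.
exact: (sqnorm_step w_gt0 w_sum1 actP S1 c0 cw (ltW d0) sS dv (IH _ eu)).
Qed.

End Decay.

(** * Subgroups of finite index *)

Section FiniteIndex.
Variable G : groupType.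
Implicit Types H K : {pred G}.

(** A finite colouring that separates the right cosets of H, rather than their
actual count: colourings pair up under intersection and restrict from any
finite orbit. *)
Definition finite_index H : Prop :=
  exists (I : finType) (c : G -> I), forall g h, c g = c h -> g / h \in H.

Lemma finite_indexS H K : {subset H <= K} -> finite_index H -> finite_index K.
Proof. by move=> HK [I [c cP]]; exists I, c => g h /cP/HK. Qed.

Lemma finite_indexI H K :
  finite_index H -> finite_index K -> finite_index [predI H & K].
Proof.
move=> [I [c cP]] [J [d dP]]; exists (I * J)%type, (fun g => (c g, d g)).
by move=> g h [/cP gH /dP gK]; rewrite inE; apply/andP.
Qed.

Lemma finite_index_stabilizer (T : choiceType) (act : T -> G -> T) (t : T) :
  right_action act -> ~ infinite_orbit act t ->
  finite_index [pred g | act t g == t].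
Proof.
move=> actP /existsNP[U /forallNP tU].
have {}tU g : act t g \in U by apply/negPn/negP; exact: tU.
exists (seq_sub U), (fun g => SeqSub (tU g)) => g h /(congr1 val)/= gh.
by rewrite inE actP.2 gh right_actionK.
Qed.

(** Inversion exchanges left and right cosets, whence the colour of g^-1. *)
Lemma finite_index_left_cosets H :
  group_closed H -> finite_index H -> finite_set (left_cosets H).
Proof.
move=> HH [I [c cP]].
pose rep i := xget 1 [set g : G | c g^-1 = i].
apply: (@sub_finite_set _ _
  ((fun i => [set rep i * h | h in [set` H]]) @` [set: I])); last first.
  exact: finite_image.
move=> _ [g _ <-]; exists (c g^-1) => //=.
have repE : c (rep (c g^-1))^-1 = c g^-1.
  by apply: (@xgetPex _ 1 [set x : G | c x^-1 = c g^-1]); exists g.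
have /= rgH := cP _ _ (esym repE); have grH := cP _ _ repE.
rewrite !invgK in rgH grH; apply/seteqP; split=> _ [h /= hH <-].
  exists (g^-1 * rep (c g^-1) * h); last by rewrite -mulgA mulVKg.
  exact: group_closedM.
exists ((rep (c g^-1))^-1 * g * h); last by rewrite -mulgA mulVKg.
exact: group_closedM.
Qed.

Definition centralizer (d : G) : {pred G} := [pred a | a * d == d * a].

(** Schreier's argument: with representatives r of the cosets of H, the elements
of H of the form r s^(+-1) r'^-1 together with the representatives lying in H
generate H.  Hence A, the part of H commuting with these finitely many elements,
is central in H; it has finite index because their centralizers do. *)
Lemma virtually_abelian_of_fc (S : seq G) H :
  generates [set` S] -> group_closed H -> finite_index H ->
  (forall h, h \in H -> finite_index (centralizer h)) ->
  virtually_abelian G.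
Proof.
move=> genS HH Hfin Hfc; have HM := group_closedM HH; have HV := group_closedV HH.
have [I [c cP]] := Hfin.
pose rep i := xget 1 [set g : G | c g = i].
have repE g : c (rep (c g)) = c g.
  by apply: (@xgetPex _ 1 [set x : G | c x = c g]); exists g.
pose reps := [seq rep i | i <- enum I].
have repsP i : rep i \in reps by apply: map_f; rewrite mem_enum.
pose S' := S ++ [seq s^-1 | s <- S].
pose D := [seq d <- reps ++
  [seq u / r | u <- [seq r * s | r <- reps, s <- S'], r <- reps] | d \in H].
have DH d : d \in D -> d \in H by rewrite mem_filter => /andP[].
pose A : {pred G} := [pred a | (a \in H) && all (fun d => a \in centralizer d) D].
have AP a : reflect (a \in H /\ forall d, d \in D -> a * d = d * a) (a \in A).
  apply: (iffP andP) => -[aH aD]; split=> //.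
    by move=> d dD; have /eqP := allP aD d dD.
  by apply/allP => d dD; apply/eqP; exact: aD.
have Aclosed : group_closed A.
  split=> [|a b /AP[aH aD] /AP[bH bD]]; apply/AP; split.
  - exact: HH.1.
  - by move=> d _; rewrite mul1g mulg1.
  - exact: HH.2.
  - move=> d dD; apply: commute_sym; apply: commuteM; first exact/esym/aD.
    by apply: commuteV; exact/esym/bD.
have Afin : finite_index A.
  rewrite /A; elim: (D) DH => [|d r IH] DH.
    by apply: finite_indexS Hfin => a aH; rewrite inE aH.
  have rH x : x \in r -> x \in H by move=> xr; apply: DH; rewrite inE xr orbT.
  have dH : d \in H by apply: DH; rewrite inE eqxx.
  apply: finite_indexS (finite_indexI (IH rH) (Hfc d dH)) => a.
  by move=> /andP[/andP[aH ar] ad]; apply/and3P.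
pose B : {pred G} := [pred b | (b \in H) && `[< forall a, a \in A -> commute b a >]].
have BP b : reflect (b \in H /\ forall a, a \in A -> commute b a) (b \in B).
  by apply: (iffP andP) => -[? /asboolP].
have DB d : d \in D -> d \in B.
  by move=> dD; apply/BP; split=> [|a /AP[_ aD]]; [exact: DH|exact/esym/aD].
have BM b b' : b \in B -> b' \in B -> b * b' \in B.
  move=> /BP[bH bA] /BP[bH' bA']; apply/BP; split; first exact: HM.
  move=> a aA; apply: commute_sym.
  by apply: commuteM; apply: commute_sym; [exact: bA|exact: bA'].
(* B is the centralizer of A in H; multiplication by a good g maps the union of
   the cosets B r into itself, and that union will be all of G. *)
pose good g := forall i, exists j, rep i * g / rep j \in B.
have goodM g h : good g -> good h -> good (g * h).
  move=> gg gh i; have [j jB] := gg i; have [k kB] := gh j; exists k.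
  by have := BM _ _ jB kB; rewrite !mulgA mulgVK.
have goodS s : s \in S' -> good s.
  move=> sS i; exists (c (rep i * s)); apply: DB.
  rewrite mem_filter cP ?repE//= mem_cat; apply/orP; right.
  by apply: allpairs_f => //; exact: allpairs_f.
have good1 : good 1.
  move=> i; exists i; rewrite mulg1 mulgV; apply/BP; split; first exact: HH.1.
  by move=> a _; rewrite /commute mul1g mulg1.
have goodT g : good g.
  move: g; apply: (generates_ind genS) => // s sS; split; apply: goodS; rewrite mem_cat.
    by rewrite (_ : s \in S).
  by rewrite map_f ?orbT.
(* For h in H the product r0 h lies in B r with r again in H, and r0, r are then
   among the elements that A commutes with. *)
have HA h a : h \in H -> a \in A -> commute h a.
  move=> hH aA; pose r0 := rep (c 1).
  have r0H : r0 \in H by have := cP (rep (c 1)) 1; rewrite divg1; apply; exact: repE.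
  have r0D : r0 \in D by rewrite mem_filter r0H mem_cat repsP.
  have [j /[dup] jB /BP[jH _]] := goodT h (c 1).
  have jD : rep j \in D.
    rewrite mem_filter mem_cat repsP andbT.
    rewrite (_ : rep j = (r0 * h / rep j)^-1 * (r0 * h)); last first.
      by rewrite invgF mulgVK.
    by apply/HM; [exact: HV|exact: HM].
  have /BP[_ /(_ a aA)] := BM _ _ jB (DB _ jD).
  rewrite mulgVK => r0h; have /BP[_ /(_ a aA)] := DB _ r0D => r0a.
  rewrite (_ : h = r0^-1 * (r0 * h)); last by rewrite mulKg.
  apply: commute_sym; apply: commuteM; last exact: commute_sym.
  by apply: commuteV; exact: commute_sym.
exists A; split=> //; last exact: finite_index_left_cosets.
by move=> a b /AP[aH _]; exact: HA.
Qed.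

End FiniteIndex.

(** * The FC-centre *)

Section FCCenter.
Variable G : groupType.

Lemma conjg_action : right_action (@conjg G).
Proof. by split=> *; rewrite ?conjg1 ?conjgM. Qed.

Definition fc_center : {pred G} := [pred b | `[< ~ infinite_orbit (@conjg G) b >]].

Lemma fc_centerP b :
  reflect (exists U : seq G, forall g, b ^ g \in U) (b \in fc_center).
Proof.
rewrite inE; apply: (iffP (asboolP _)) => [/existsNP[U /forallNP bU]|[U bU] /(_ U)[g]].
  by exists U => g; apply/negPn/negP; exact: bU.
by rewrite bU.
Qed.

Lemma fc_center_closed : group_closed fc_center.
Proof.
split=> [|a b /fc_centerP[U aU] /fc_centerP[V bV]]; apply/fc_centerP.
  by exists [:: 1] => g; rewrite conj1g inE.
exists [seq x / y | x <- U, y <- V] => g.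
by rewrite conjMg conjVg; exact: allpairs_f.
Qed.

Lemma fc_centerJ b g : (b ^ g \in fc_center) = (b \in fc_center).
Proof.
apply/fc_centerP/fc_centerP => -[U bU]; exists U => h; last by rewrite -conjgM.
by have := bU (g^-1 * h); rewrite -conjgM mulVKg.
Qed.

Lemma finite_index_centralizer b : b \in fc_center -> finite_index (centralizer b).
Proof.
move=> /asboolP /(finite_index_stabilizer conjg_action).
apply: finite_indexS => g; rewrite !inE => /eqP bg.
by rewrite (conjgC b) bg.
Qed.

(** The set X g; the orbit of a subgroup is its set of right cosets. *)
Definition translate (X : set G) (g : G) : set G := [set x | X (x / g)].

Lemma translate_action : right_action translate.
Proof.
split=> [X|X g h]; apply/seteqP; split=> x; rewrite /translate/= ?divg1//.
  by rewrite invgM mulgA.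
by rewrite invgM mulgA.
Qed.

Lemma translate_stabilizer (H : {pred G}) g :
  group_closed H -> translate [set` H] g = [set` H] -> g \in H.
Proof.
move=> HH Hg; have : translate [set` H] g g by rewrite /translate/= mulgV; exact: HH.1.
by rewrite Hg.
Qed.

Lemma translateE (H : {pred G}) g h : group_closed H -> g / h \in H ->
  translate [set` H] g = translate [set` H] h.
Proof.
move=> HH gh; have HM := group_closedM HH; have HV := group_closedV HH.
apply/seteqP; rewrite /translate; split=> x /= xH.
  by rewrite -(divgKA g); exact: HM.
by rewrite -(divgKA h); apply: HM => //; rewrite -invgF; exact: HV.
Qed.

End FCCenter.

(** * Many involutions force a large FC-centre *)

Section InvolutionsInWalk.
Local Open Scope ring_scope.
Context (R : realType) (G : groupType) (S : seq G) (w : G -> R).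
Hypothesis w_gt0 : forall s, s \in S -> 0 < w s.
Hypothesis w_sum1 : \sum_(s <- S) w s = 1.
Hypothesis S1 : 1%g \in S.
Hypothesis genS : generates [set` S].

Notation E := (expect S w).

(** The involution x y inverts b = y^-1 y', because the product (x y) b = x y' is
again an involution; conjugating back by y gives the action of x alone. *)
Lemma conj_of_involutions (x y y' : G) :
  ((x * y) ^+ 2 = 1)%g -> ((x * y') ^+ 2 = 1)%g -> ((y^-1 * y') ^ x = y / y')%g.
Proof.
rewrite !expg2 => xy xy'.
have e1 : (x^-1 * y^-1 = y * x)%g.
  rewrite -invgM; apply: mulg1_eq; apply: (mulgI x).
  by rewrite mulg1 -[RHS]mul1g -xy !mulgA.
have e2 : (y'^-1 = x * y' * x)%g.
  apply: mulg1_eq; apply: (mulgI x).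
  by rewrite !mulgA mulg1 -[RHS]mul1g -xy' !mulgA.
by rewrite conjgE e2 !mulgA e1.
Qed.

(** The square of an expectation is an expectation over two independent copies. *)
Lemma expectM n (F : G -> R) :
  E n F ^+ 2 = E n (fun g => E n (fun h => F g * F h)).
Proof.
by rewrite expr2 -expectZ; apply: eq_expect => g; rewrite expectZ mulrC.
Qed.

(** For given y and y', either y^-1 y' lies in the FC-centre, or x sends it to the
prescribed conjugate with probability less than e.  If the cosets of the
FC-centre were infinite in number, the first case would have probability less
than e in y' as well, and c^2 <= 2 e contradicts e = c^2 / 3. *)
Lemma fc_center_finite_index (c : R) : 0 < c ->
  (forall N : nat, exists2 n, (N <= n)%N &
    c <= E n (fun g => ((g ^+ 2)%g == 1%g)%:R)) ->
  finite_index (@fc_center G).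
Proof.
move=> c0 often; have FH := fc_center_closed G.
suff : ~ infinite_orbit (@translate G) [set` @fc_center G].
  move=> /(finite_index_stabilizer (translate_action G)); apply: finite_indexS => g.
  by move=> /eqP; exact: translate_stabilizer.
move=> Finf; pose e := c ^+ 2 / 3.
have e0 : 0 < e by rewrite divr_gt0// exprn_gt0.
have [N decay] := hit_decay w_gt0 w_sum1 S1 genS e0.
have [n Nn] := often (N + N)%N.
have [k nE Nk] : exists2 k, n = (N + k)%N & (N <= k)%N.
  have NleN : (N <= n)%N by rewrite (leq_trans (leq_addr N N)).
  by exists (n - N)%N; [rewrite subnKC|rewrite leq_subRL].
rewrite {}nE expect_add => cE.
pose I (x y : G) : R := (((x * y) ^+ 2)%g == 1%g)%:R.
have : c ^+ 2 <= E N (fun x => E k (I x) ^+ 2).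
  apply: le_trans (sqr_expect_le w_gt0 w_sum1 _ _).
  by rewrite lerXn2r// nnegrE ?(ltW (lt_le_trans c0 cE)) ?(ltW c0).
rewrite (eq_expect _ _ _ (fun x => expectM k (I x))) expect_exchange.
rewrite (eq_expect _ _ _ (fun y =>
  expect_exchange _ _ N k (fun x y' => I x y * I x y'))).
apply/negP; rewrite -ltNge.
have bound y : E k (fun y' => E N (fun x => I x y * I x y')) <= e + e.
  apply: (@le_trans _ _ (hit S w (@translate G) k [set` @fc_center G]
      (translate [set` @fc_center G] y) + e)); last first.
    by rewrite lerD2r ltW// decay//; exact: translate_action.
  rewrite -[X in _ + X](expect_cst w_sum1 k) -expectD.
  apply: (le_expect w_gt0) => y'.
  have [bF|bF] := boolP ((y^-1 * y')%g \in @fc_center G).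
    (* The FC-centre is normal, so y^-1 y' and y' y^-1 lie in it together. *)
    have -> : translate [set` @fc_center G] y' = translate [set` @fc_center G] y.
      apply: translateE => //; rewrite -(fc_centerJ _ y).
      by rewrite conjgE mulgVK.
    rewrite eqxx ler_wpDr ?(ltW e0)// -[leRHS](expect_cst w_sum1 N).
    apply: (le_expect w_gt0) => x; rewrite /I.
    by case: eqP => _; case: eqP => _; rewrite ?mulr1 ?mulr0.
  rewrite ler_wpDl ?ler0n//.
  have binf : infinite_orbit (@conjg G) (y^-1 * y')%g.
    by apply: contrapT => /asboolP; exact/negP.
  apply: le_trans (ltW (decay N (leqnn N) _ _ (conjg_action G) _ (y / y')%g binf)).
  apply: (le_expect w_gt0) => x; rewrite /I.
  case: eqP => xy; last by rewrite mul0r ler0n.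
  case: eqP => xy'; last by rewrite mulr0 ler0n.
  by rewrite conj_of_involutions// eqxx mulr1.
apply: le_lt_trans (_ : _ <= e + e) _; last by rewrite /e; have := exprn_gt0 2 c0; lra.
rewrite -[leRHS](expect_cst w_sum1 k).
exact: (le_expect w_gt0).
Qed.

End InvolutionsInWalk.

(** * The law of the random walk *)

Section LawOfWalk.
Context (R : realType) (G : groupType) (mu : probability (discrete G) R).
Local Open Scope ring_scope.

Definition mass (g : G) : R := fine (mu [set g]).

Lemma massE g : mu [set g] = (mass g)%:E.
Proof. by rewrite fineK// fin_num_measure. Qed.

Lemma mass_ge0 g : 0 <= mass g.
Proof. by rewrite fine_ge0. Qed.

Lemma support_seq : finitely_supported mu ->
  exists S : seq G, [/\ forall g, (g \in S) = (0 < mass g),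
    \sum_(s <- S) mass s = 1 & mu (~` [set` S]) = 0%E].
Proof.
move=> [F Ffin muF].
have fin_sum (X : {fset G}) : mu [set` X] = (\sum_(g <- X) mass g)%:E.
  transitivity (mu (\big[setU/set0]_(i <- X) [set i])).
    rewrite -bigcup_fset; congr (mu _).
    by apply/seteqP; split=> [g gX|_ [g gX ->]] //; exists g.
  rewrite measure_fbigsetU => [||]//.
    by rewrite -sumEFin; apply: eq_bigr => g _; exact: massE.
  by move=> i j _ _ [g [-> ->]].
pose X := fset_set F; pose S := [fset g in X | 0 < mass g]%fset.
have XF : [set` X] = F.
  by apply/seteqP; split=> g /=; rewrite in_fset_set// inE.
have S1 : \sum_(s <- S) mass s = 1.
  have : (\sum_(g <- X) mass g)%:E = 1%E by rewrite -fin_sum XF.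
  case=> <-; rewrite [RHS](bigID (fun g => 0 < mass g))/= [X in _ + X]big1 ?addr0.
    by rewrite big_fset.
  by move=> g; rewrite lt_neqAle mass_ge0 andbT negbK => /eqP.
have muS : mu (~` [set` S]) = 0%E.
  by rewrite probability_setC// fin_sum S1 subee.
exists S; split=> // g; rewrite !inE.
apply/andP/idP => [[]//|g0]; split=> //.
apply: contraTT g0 => gX; rewrite -leNgt -lee_fin -massE.
apply: (@le_trans _ _ (mu (~` [set` S]))); last by rewrite muS.
rewrite le_measure ?inE//.
by move=> _ ->; rewrite /= !inE (negbTE gX).
Qed.

Context (d : measure_display) (Omega : measurableType d) (P : probability Omega R)
  (x : nat -> {RV P >-> discrete G}).
Hypothesis Gcountable : countable [set: G].

Lemma measurable_step n (A : set G) : measurable (x n @^-1` A).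
Proof. by rewrite -[X in measurable X]setTI; exact: (measurable_funP (x n)). Qed.

(** The product of two measurable maps into G need not be measurable for the
discrete sigma-algebra in general; for countable G the event is a countable
union over the last step. *)
Lemma measurable_walk n (A : set G) :
  measurable [set z : Omega | A (random_walk x n z)].
Proof.
elim: n A => [|n IH] A.
  have [A1|A1] := pselect (A 1%g).
    by rewrite (_ : [set _ | _] = setT)//; apply/seteqP; split.
  by rewrite (_ : [set _ | _] = set0)//; apply/seteqP; split.
rewrite (_ : [set _ | _] = \bigcup_s
    ([set z | [set g : G | A (g * s)%g] (random_walk x n z)] `&` x n @^-1` [set s])).
  apply: countable_bigcupT_measurable => // s.
  by apply: measurableI; [exact: IH|exact: measurable_step].
apply/seteqP; split=> [z Ao | z [s _]]; first by exists (x n z).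
by case=> Ao /= xs; rewrite -xs in Ao.
Qed.

Definition cylinder n (s : nat -> G) : set Omega :=
  [set z | forall i, (i < n)%N -> x i z = s i].

Lemma cylinderS n s : cylinder n.+1 s = cylinder n s `&` x n @^-1` [set s n].
Proof.
apply/seteqP; split=> [z zs|z [zs zn] i] /=.
  by split=> [i /ltnW|]; exact: zs.
by rewrite ltnS leq_eqVlt => /predU1P[->|/zs].
Qed.

Lemma measurable_cylinder n s : measurable (cylinder n s).
Proof.
elim: n => [|n IH]; first by rewrite (_ : cylinder _ _ = setT)//; apply/seteqP; split.
by rewrite cylinderS; apply: measurableI => //; exact: measurable_step.
Qed.

Lemma cylinder_prob n s : iid mu x ->
  P (cylinder n s) = (\prod_(i < n) mass (s i))%:E.
Proof.
move=> [indep law].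
have := indep [fset i | i in index_iota 0 n]%fset (fun i => [set s i]) (fun _ _ => I).
rewrite (_ : \bigcap_(i in _) _ = cylinder n s) => [->|].
  rewrite big_imfset//= undup_id ?iota_uniq// big_mkord -prodEFin.
  by apply: eq_bigr => i _; rewrite -massE -(law i).
apply/seteqP; split=> [z zs i iN|z zs i /imfsetP[j /=]].
  by apply: zs; apply/imfsetP; exists i => //=; rewrite mem_index_iota.
by rewrite mem_index_iota => jn ->; exact: zs.
Qed.

Variable S : seq G.
Hypothesis muS : mu (~` [set` S]) = 0%E.
Hypothesis law : forall n A, measurable A -> distribution P (x n) A = mu A.

(** Induction on n peels off the last step x_n = s and absorbs it into Q.  The
hypothesis on Q, independence from the cylinders of the first n steps, is what
this absorption preserves, so the joint independence of the steps enters only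
through [cylinder_prob]. *)
Lemma walk_prob_le n (A : set G) (Q : set Omega) (q : R) : measurable Q ->
  (forall s, P (cylinder n s `&` Q) <= (\prod_(i < n) mass (s i) * q)%:E)%E ->
  (P ([set z | A (random_walk x n z)] `&` Q)
    <= (expect S mass n (fun g => (g \in A)%:R) * q)%:E)%E.
Proof.
elim: n A Q q => [|n IH] A Q q mQ Qq.
  rewrite expect0; have [A1|A1] := boolP (1%g \in A).
    have := Qq (fun=> 1%g); rewrite big_ord0; apply: le_trans.
    rewrite le_measure ?inE//; [| |by move=> z [_ ?]; split].
      by apply: measurableI => //; exact: (measurable_walk 0).
    by apply: measurableI => //; exact: measurable_cylinder.
  rewrite mul0r (_ : _ `&` _ = set0) ?measure0//.
  by apply/seteqP; split=> // z [/= Ao _]; rewrite notin_setE in A1.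
pose E s := [set z | [set g : G | A (g * s)%g] (random_walk x n z)] `&`
  (x n @^-1` [set s] `&` Q).
have mE s : measurable (E s).
  apply: measurableI; first exact: measurable_walk.
  by apply: measurableI => //; exact: measurable_step.
have mN : measurable (x n @^-1` (~` [set` S])) by exact: measurable_step.
have mU (r : seq G) : measurable (\big[setU/set0]_(s <- r) E s).
  by apply: bigsetU_measurable.
have cover : [set z | A (random_walk x n.+1 z)] `&` Q `<=`
    x n @^-1` (~` [set` S]) `|` \big[setU/set0]_(s <- S) E s.
  move=> z [Ao Qo]; have [xS|xS] := pselect ([set` S] (x n z)); last by left.
  by right; rewrite -bigcup_seq; exists (x n z).
apply: (@le_trans _ _ (P (x n @^-1` (~` [set` S]) `|` \big[setU/set0]_(s <- S) E s))).
  rewrite le_measure ?inE//; last exact: measurableU.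
  by apply: measurableI => //; exact: measurable_walk.
have null : (P (x n @^-1` (~` [set` S])) <= 0)%E by rewrite -muS -(law n).
apply: (le_trans (measureU2 _ mN (mU S))); rewrite -[leRHS]add0e; apply: leeD => //.
apply: (@le_trans _ _ (\sum_(s <- S) P (E s))%E).
  elim: S => [|s r IHr]; first by rewrite !big_nil measure0.
  rewrite !big_cons; apply: (le_trans (measureU2 _ (mE s) (mU r))).
  by rewrite leeD2l.
rewrite expectS mulr_suml -sumEFin; apply: lee_sum => s _.
rewrite (mulrC (mass s)) -mulrA.
have -> : (fun g => ((g * s)%g \in A)%:R) =
    (fun g => (g \in [set g : G | A (g * s)%g])%:R) :> (G -> R).
  by apply/funext => g; congr (_%:R); rewrite !inE.
apply: IH => [|t]; first by apply: measurableI => //; exact: measurable_step.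
pose t' i := if i == n then s else t i.
have := Qq t'; rewrite big_ord_recr/= /t' eqxx -mulrA.
rewrite (eq_bigr (fun i : 'I_n => mass (t i))) => [|i _]; last first.
  by rewrite ltn_eqF.
apply: le_trans; rewrite cylinderS /t' eqxx -setIA.
rewrite (_ : cylinder n _ = cylinder n t)//.
by apply/seteqP; split=> z ot i iN; have := ot i iN; rewrite ltn_eqF.
Qed.

End LawOfWalk.

Section Limsup.
Local Open Scope ereal_scope.
Context (R : realType).

Lemma limn_esup_gt0_often (u : (\bar R)^nat) : (forall n, u n <= 1) ->
  0 < limn_esup u ->
  exists2 c : R, (0 < c)%R & forall N : nat, exists2 n, (N <= n)%N & c%:E <= u n.
Proof.
move=> u1; set L := limn_esup u => L0.
have Lsup N : L <= ereal_sup [set u n | n in [set n | (N <= n)%N]].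
  by apply: ereal_inf_lbound; exists [set n | (N <= n)%N] => //; exists N.
have L1 : L <= 1.
  by apply: (le_trans (Lsup 0%N)); apply: ge_ereal_sup => _ [n _ <-].
have [l lE] : exists l, L = l%:E.
  exists (fine L); rewrite fineK// fin_real//.
  by rewrite (lt_trans _ L0) ?ltNyr//= (le_lt_trans L1) ?ltry.
rewrite lE lte_fin in L0 Lsup; exists (l / 2)%R; first by rewrite divr_gt0.
move=> N; have : (l / 2)%:E < ereal_sup [set u n | n in [set n | (N <= n)%N]].
  by apply: lt_le_trans (Lsup N); rewrite lte_fin; lra.
by move=> /ereal_sup_gt[_ [n Nn <-] /ltW]; exists n.
Qed.

End Limsup.

(** * The theorem *)

Theorem theorem5p1 (R : realType) (G : groupType)
    (mu : probability (discrete G) R)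
    (d : measure_display) (Omega : measurableType d) (P : probability Omega R)
    (x : nat -> {RV P >-> discrete G}) :
  finitely_generated G ->
  finitely_supported mu ->
  generates (msupport mu) ->
  (0 < mu [set (1%g : G)])%E ->
  iid mu x ->
  (0 < limn_esup (fun n : nat =>
         P [set w : Omega | ((random_walk x n w : G) ^+ 2 = 1)%g]))%E ->
  virtually_abelian G.
Proof.
move=> _ /support_seq[S [SE S1 muS]] gen mu1 iidx limsup.
have genS : generates [set` S].
  rewrite (_ : [set` S] = msupport mu)//.
  by apply/seteqP; split=> g; rewrite /msupport /= SE massE lte_fin.
have S_gt0 s : s \in S -> (0 < mass mu s)%R by rewrite SE.
have one_S : 1 \in S by rewrite SE -lte_fin -massE.
have cG := generates_countable genS.
have [n|c c0 often] := limn_esup_gt0_often _ limsup.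
  apply: probability_le1.
  exact: (measurable_walk x cG n [set g : G | g ^+ 2 = 1]).
apply: (virtually_abelian_of_fc genS (fc_center_closed G)); last first.
  exact: finite_index_centralizer.
apply: (fc_center_finite_index S_gt0 S1 one_S genS c0) => N.
have [n Nn cn] := often N; exists n => //.
rewrite -lee_fin; apply: (le_trans cn).
rewrite -[X in P X]setIT.
rewrite -[in leRHS](mulr1 (expect _ _ _ _)).
rewrite (@eq_expect _ _ _ _ _ _
  (fun g => (g \in [set h : G | (h ^+ 2 = 1)%g])%:R)%R); last first.
  by move=> g; congr ((nat_of_bool _)%:R)%R; apply/eqP/idP; rewrite inE.
apply: (walk_prob_le cG muS iidx.2 _ measurableT) => s.
by rewrite setIT mulr1 (cylinder_prob n s iidx).
Qed.
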